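(* Let $H_1,H_2$ be real Hilbert spaces, let $C\subset H_1$ and $Q\subset H_2$ be nonempty closed convex subsets, let $A:H_1\to H_2$ be a bounded linear operator, and let $f:C\times C\to\mathbb{R}$ and $g:Q\times Q\to\mathbb{R}$ be bifunctions. Then the split equilibrium problem (SEP) determined by $(C,Q,A,f,g)$ is well-posed if and only if its solution set $S$ is nonempty and $\operatorname{diam}(S(\epsilon))\to 0$ as $\epsilon\to 0$ (with $\epsilon>0$).
   Context: The product $H_1\times H_2$ carries its usual Hilbert space norm. Split equilibrium problem (SEP): find $x^*\in C$ such that $f(x^*,p)\ge 0$ for all $p\in C$, and such that $y^*=Ax^*$ belongs to $Q$ and satisfies $g(y^*,q)\ge 0$ for all $q\in Q$. A solution is identified with the pair $(x^*,y^* )=(x^*,Ax^* )$, so the solution set is $$S=\{(x,y)\in C\times Q:\ y=Ax,\ f(x,p)\ge 0\ \forall p\in C,\ g(y,q)\ge 0\ \forall q\in Q\}.$$ For $\epsilon\ge 0$, the approximate solution set is $$S(\epsilon)=\{(x,y)\in C\times Q:\ \|y-Ax\|\le\epsilon,\ f(x,p)\ge-\epsilon\ \forall p\in C,\ g(y,q)\ge-\epsilon\ \forall q\in Q\}.$$ A sequence $\{(x_n,y_n)\}$ in $H_1\times H_2$ is an approximating sequence for the SEP if there exist real numbers $\epsilon_n>0$ with $\epsilon_n\to 0$ such that, for all $n$: $x_n\in C$, $y_n\in Q$, $\|y_n-Ax_n\|\le\epsilon_n$, $f(x_n,p)\ge-\epsilon_n$ for all $p\in C$, and $g(y_n,q)\ge-\epsilon_n$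 for all $q\in Q$. The SEP is well-posed if $S$ is a singleton and every approximating sequence for the SEP converges (in norm) to the unique element of $S$. The diameter of a set $B$ is $\operatorname{diam}(B)=\sup\{\|u-v\|:u,v\in B\}$ (possibly $+\infty$). *)

(* Defs.v *)
From HB Require Import structures.
From mathcomp Require Import all_boot all_order all_algebra.
From mathcomp Require Import all_classical all_reals all_analysis.

Set Implicit Arguments.
Unset Strict Implicit.
Unset Printing Implicit Defensive.

Import Order.TTheory GRing.Theory Num.Theory.
Import numFieldNormedType.Exports.

Local Open Scope classical_set_scope.
Local Open Scope ring_scope.

(* Real Hilbert spaces: complete normed modules over a realType whose norm is
   induced by an inner product. *)
HB.mixin Record isHilbert (R : realType) H of CompleteNormedModule R H := {
  inner : {dot H for (@idfun R)} ;
  sqr_norm_inner : forall x : H, `|x| ^+ 2 = inner x x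
}.

#[short(type="hilbertType")]
HB.structure Definition Hilbert (R : realType) :=
  {H of isHilbert R H & CompleteNormedModule R H}.

(* The norm that the library puts on the product type H1 * H2 is the max norm;
   the Hilbert norm of the product is therefore defined separately, from the
   inner product of the Hilbert sum of H1 and H2. *)
Definition prod_inner (R : realType) (H1 H2 : hilbertType R)
    (u v : H1 * H2) : R :=
  (inner : {dot H1 for idfun}) u.1 v.1 + (inner : {dot H2 for idfun}) u.2 v.2.

Definition prod_norm (R : realType) (H1 H2 : hilbertType R) (u : H1 * H2) : R :=
  Num.sqrt (prod_inner u u).

Lemma prod_normE (R : realType) (H1 H2 : hilbertType R) (u : H1 * H2) :
  prod_norm u = Num.sqrt (`|u.1| ^+ 2 + `|u.2| ^+ 2).
Proof. by rewrite /prod_norm /prod_inner -!sqr_norm_inner. Qed.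

(* Diameter for the Hilbert norm, as an extended real; the supremum over the
   empty set is -oo. *)
Definition diam (R : realType) (H1 H2 : hilbertType R)
    (B : set (H1 * H2)) : \bar R :=
  ereal_sup [set (prod_norm (u - v))%:E | u in B & v in B].

(* Bifunctions on C and Q are represented by total functions; everywhere below
   they are only evaluated at points of C x C and Q x Q respectively. *)

Definition sep_sol (R : realType) (H1 H2 : hilbertType R)
    (C : set H1) (Q : set H2) (A : H1 -> H2)
    (f : H1 -> H1 -> R) (g : H2 -> H2 -> R) : set (H1 * H2) :=
  [set z | [/\ C z.1, Q z.2, z.2 = A z.1,
               forall p, C p -> 0 <= f z.1 p &
               forall q, Q q -> 0 <= g z.2 q]].

Definition sep_approx_sol (R : realType) (H1 H2 : hilbertType R)
    (C : set H1) (Q : set H2) (A : H1 -> H2)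
    (f : H1 -> H1 -> R) (g : H2 -> H2 -> R) (e : R) : set (H1 * H2) :=
  [set z | [/\ C z.1, Q z.2, `|z.2 - A z.1| <= e,
               forall p, C p -> - e <= f z.1 p &
               forall q, Q q -> - e <= g z.2 q]].

Definition sep_approximating (R : realType) (H1 H2 : hilbertType R)
    (C : set H1) (Q : set H2) (A : H1 -> H2)
    (f : H1 -> H1 -> R) (g : H2 -> H2 -> R) (z : nat -> H1 * H2) : Prop :=
  exists e : nat -> R,
    [/\ forall n, 0 < e n, e n @[n --> \oo] --> 0 &
        forall n, [/\ C (z n).1, Q (z n).2, `|(z n).2 - A (z n).1| <= e n,
                      forall p, C p -> - e n <= f (z n).1 p &
                      forall q, Q q -> - e n <= g (z n).2 q]].

Definition sep_well_posed (R : realType) (H1 H2 : hilbertType R)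
    (C : set H1) (Q : set H2) (A : H1 -> H2)
    (f : H1 -> H1 -> R) (g : H2 -> H2 -> R) : Prop :=
  exists s : H1 * H2,
    sep_sol C Q A f g = [set s] /\
    forall z : nat -> H1 * H2, sep_approximating C Q A f g z ->
      prod_norm (z n - s) @[n --> \oo] --> 0.

(* Main.v *)
Require Import Defs.
From mathcomp Require Import all_boot all_order all_algebra.
From mathcomp Require Import all_classical all_reals all_analysis.
From mathcomp Require Import lra.

Import Order.TTheory GRing.Theory Num.Theory.
Import numFieldNormedType.Exports.

Local Open Scope classical_set_scope.
Local Open Scope ring_scope.

(** The equivalence rests on two facts: the sets S(e) increase with e and contain
    S, and a sequence is approximating exactly when its n-th term lies in S(e_n)
    for some positive e_n tending to 0.  When S is nonempty the diameters of the
    S(e) are nonnegative, and they tend to 0 exactly when, for every d > 0, some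
    S(e) has all its pairs of points within d of each other ([diam_cvg0P]).

    If the problem is well-posed with solution s, then for e small S(e) lies in
    a given ball around s: otherwise picking a point of S(1/(n+1)) outside the
    ball for each n would give an approximating sequence that does not converge
    to s ([well_posed_approx_sol_ball]).  Hence the diameters tend to 0.

    Conversely, if s solves the problem and the diameters tend to 0, then an
    approximating sequence and s lie in a common S(e_n), so their distance is
    eventually below any d ([approximating_cvg]).  A second
    solution t is excluded because the constant sequence t is approximating. *)

Section ProductNorm.
Set Implicit Arguments.
Unset Strict Implicit.

Variables (R : realType) (H1 H2 : hilbertType R).
Implicit Types u v s : H1 * H2.

Lemma prod_norm_ge0 u : 0 <= prod_norm u.
Proof. exact: sqrtr_ge0. Qed.

Lemma prod_norm_le u (d : R) : 0 <= d ->
  (prod_norm u <= d) = (`|u.1| ^+ 2 + `|u.2| ^+ 2 <= d ^+ 2).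
Proof.
move=> d0; rewrite Defs.prod_normE -[X in (_ <= X) = _](ger0_norm d0) -sqrtr_sqr.
by rewrite ler_sqrt// sqr_ge0.
Qed.

Lemma prod_norm_eq0 u : prod_norm u = 0 -> u = 0.
Proof.
move=> u0; have : prod_norm u <= 0 by rewrite u0.
rewrite prod_norm_le// expr0n/= => le0.
have := sqr_ge0 `|u.1|; have := sqr_ge0 `|u.2| => h2 h1.
have e1 : `|u.1| ^+ 2 = 0 by lra.
have e2 : `|u.2| ^+ 2 = 0 by lra.
move/eqP: e1; move/eqP: e2; rewrite !sqrf_eq0 !normr_eq0.
by case: u {u0 le0 h1 h2} => a b /= /eqP -> /eqP ->.
Qed.

(** Coming from |x - y|^2 <= 2 (|x|^2 + |y|^2) in each factor, this has the
    same constant as the triangle inequality for points of a common ball, and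
    so spares the Cauchy-Schwarz inequality in the product. *)
Lemma prod_norm_ball u v s (d : R) :
  prod_norm (u - s) <= d -> prod_norm (v - s) <= d ->
  prod_norm (u - v) <= 2 * d.
Proof.
move=> us vs; have d0 : 0 <= d := le_trans (prod_norm_ge0 _) us.
move: us vs; rewrite !prod_norm_le ?mulr_ge0//=.
have sqr_normB (V : normedModType R) (x y z : V) :
    `|x - y| ^+ 2 <= 2 * (`|x - z| ^+ 2 + `|y - z| ^+ 2).
  have xy : `|x - y| <= `|x - z| + `|y - z|.
    by rewrite (distrC y z); exact: ler_distD.
  have := normr_ge0 (x - y).
  by have := sqr_ge0 (`|x - z| - `|y - z|); nra.
by have := sqr_normB _ u.1 v.1 s.1; have := sqr_normB _ u.2 v.2 s.2; nra.
Qed.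

Lemma prod_norm_le_diam (B : set (H1 * H2)) u v : B u -> B v ->
  ((prod_norm (u - v))%:E <= diam B)%E.
Proof. by move=> Bu Bv; apply: ereal_sup_ubound; exists u => //; exists v. Qed.

Lemma diam_le (B : set (H1 * H2)) (d : R) :
  (forall u v, B u -> B v -> prod_norm (u - v) <= d) -> (diam B <= d%:E)%E.
Proof.
by move=> Bd; apply: ge_ereal_sup => _ [u Bu [v Bv <-]]; rewrite lee_fin Bd.
Qed.

(** Nonemptiness keeps the diameters away from -oo, the supremum over the empty
    set. *)
Lemma diam_cvg0P (B : R -> set (H1 * H2)) :
  (forall e, 0 < e -> B e !=set0) ->
  (forall e e', e <= e' -> B e `<=` B e') ->
  diam (B e) @[e --> 0^'+] --> (0 : \bar R)%E <->
  forall d : R, 0 < d -> exists2 e, 0 < e &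
    forall u v, B e u -> B e v -> prod_norm (u - v) <= d.
Proof.
move=> B0 Bmono; split=> [Bcvg d d0|Bd].
  have diam_small : \forall e \near 0^'+, (diam (B e) < d%:E)%E.
    have zero_lt : ((0 : R)%:E < d%:E)%E by rewrite lte_fin.
    exact: Bcvg _ (open_ereal_lt' zero_lt).
  have [e [e0 Bed]] := filter_ex (filterI (nbhs_right_gt (0 : R)) diam_small).
  exists e => // u v Bu Bv; rewrite -lee_fin.
  exact: le_trans (prod_norm_le_diam Bu Bv) (ltW Bed).
have diam_bounds d : 0 < d ->
    \forall e \near 0^'+, (0 <= diam (B e) <= d%:E)%E.
  move=> d0; have [e0 e0_gt0 Be0] := Bd d d0.
  near=> e; apply/andP; split.
    have e_gt0 : 0 < e by near: e; exact: nbhs_right_gt.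
    have [u Bu] := B0 e e_gt0.
    apply: le_trans (prod_norm_le_diam Bu Bu).
    by rewrite lee_fin prod_norm_ge0.
  have ee0 : e <= e0 by near: e; exact: nbhs_right_le.
  by apply: diam_le => u v /(Bmono _ _ ee0) Bu /(Bmono _ _ ee0); exact: Be0.
apply/fine_cvgP; split.
  have := diam_bounds 1 ltr01; apply: filterS => e /= /andP[ge0 le1].
  by rewrite ge0_fin_numE// (le_lt_trans le1)// ltry.
apply/cvgrPdist_le => d d0.
have := diam_bounds d d0; apply: filterS => e /=.
case: (diam (B e)) => [r| |] //=.
  by rewrite !lee_fin sub0r normrN => /andP[r0]; rewrite ger0_norm.
by rewrite subr0 normr0 ltW.
Unshelve. all: by end_near. Qed.

End ProductNorm.

Section SplitEquilibrium.
Set Implicit Arguments.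
Unset Strict Implicit.

Variables (R : realType) (H1 H2 : hilbertType R).
Variables (C : set H1) (Q : set H2) (A : H1 -> H2).
Variables (f : H1 -> H1 -> R) (g : H2 -> H2 -> R).

Local Notation S := (sep_sol C Q A f g).
Local Notation S_ := (sep_approx_sol C Q A f g).

Lemma sep_approx_sol_mono (e e' : R) : e <= e' -> S_ e `<=` S_ e'.
Proof.
move=> ee' z [Cz Qz Az fz gz]; split=> // [|p Cp|q Qq].
- exact: le_trans Az ee'.
- by apply: le_trans (fz p Cp); rewrite lerN2.
- by apply: le_trans (gz q Qq); rewrite lerN2.
Qed.

Lemma sep_sol_approx (e : R) : 0 <= e -> S `<=` S_ e.
Proof.
move=> e0 z [Cz Qz Az fz gz]; split=> // [|p Cp|q Qq].
- by rewrite Az subrr normr0.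
- by apply: le_trans (fz p Cp); rewrite oppr_le0.
- by apply: le_trans (gz q Qq); rewrite oppr_le0.
Qed.

Lemma sep_approximating_harmonic (z : nat -> H1 * H2) :
  (forall n, S_ (harmonic n) (z n)) -> sep_approximating C Q A f g z.
Proof.
move=> Sz; exists harmonic; split=> [n||n]; last exact: Sz.
- exact: harmonic_gt0.
- exact: cvg_harmonic.
Qed.

(** The negation says that every S(e) has a point outside the ball; choosing one
    for each e = 1/(n+1) makes an approximating sequence that stays away from
    s. *)
Lemma well_posed_approx_sol_ball (s : H1 * H2) (d : R) :
  (forall z, sep_approximating C Q A f g z ->
     prod_norm (z n - s) @[n --> \oo] --> 0) ->
  0 < d ->
  exists2 e, 0 < e & forall z, S_ e z -> prod_norm (z - s) <= d.
Proof.
move=> wp d0; apply: contrapT => no_ball.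
have far n : exists z, S_ (harmonic n) z /\ d < prod_norm (z - s).
  apply: contrapT => near_s; apply: no_ball.
  exists (harmonic n) => [|z Sz]; first exact: harmonic_gt0.
  by rewrite leNgt; apply/negP => dz; apply: near_s; exists z.
have [z zP] := choice far.
have /wp/cvgrPdist_lt/(_ d d0) : sep_approximating C Q A f g z.
  by apply: sep_approximating_harmonic => n; have [] := zP n.
case=> N _ /(_ N (leqnn N)) /=.
rewrite sub0r normrN ger0_norm ?prod_norm_ge0// => zd.
by have [_ dz] := zP N; have := lt_trans dz zd; rewrite ltxx.
Qed.

(** Solutions belong to every S(e), so once e_n is small enough z n and s both
    lie in a set of small diameter. *)
Lemma approximating_cvg (s : H1 * H2) (z : nat -> H1 * H2) :
  S s ->
  (forall d : R, 0 < d -> exists2 e, 0 < e &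
    forall u v, S_ e u -> S_ e v -> prod_norm (u - v) <= d) ->
  sep_approximating C Q A f g z ->
  prod_norm (z n - s) @[n --> \oo] --> 0.
Proof.
move=> Ss small [e [e0 ecvg Sz]]; apply/cvgrPdist_le => d d0.
have [e1 e1_gt0 Se1] := small d d0.
move/cvgrPdist_le : ecvg => /(_ e1 e1_gt0); apply: filterS => n.
rewrite !sub0r !normrN (ger0_norm (prod_norm_ge0 _)) (gtr0_norm (e0 n)) => en.
apply: Se1; last exact: sep_sol_approx (ltW e1_gt0) _ Ss.
exact: sep_approx_sol_mono en _ (Sz n).
Qed.

End SplitEquilibrium.

Theorem theorem3p3 (R : realType) (H1 H2 : hilbertType R)
    (C : set H1) (Q : set H2) (A : {linear H1 -> H2})
    (f : H1 -> H1 -> R) (g : H2 -> H2 -> R)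
    (C0 : C !=set0) (Ccl : closed C) (Ccvx : convex_set C)
    (Q0 : Q !=set0) (Qcl : closed Q) (Qcvx : convex_set Q)
    (Abd : exists k : R, forall x : H1, `|A x| <= k * `|x|) :
  sep_well_posed C Q A f g <->
  (sep_sol C Q A f g !=set0 /\
   diam (sep_approx_sol C Q A f g e) @[e --> 0^'+] --> (0 : \bar R)%E).
Proof.
have diamP s (Ss : sep_sol C Q A f g s) :=
  diam_cvg0P (fun e e0 => ex_intro _ s (sep_sol_approx (ltW e0) Ss))
    (@sep_approx_sol_mono _ _ _ C Q A f g).
split=> [[s [Seq wp]]|[[s Ss] /(diamP s Ss) small]].
  have Ss : sep_sol C Q A f g s by rewrite Seq.
  split; first by exists s.
  apply/(diamP s Ss) => d d0.
  have d2 : 0 < d / 2 by rewrite divr_gt0.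
  have [e e0 ball_s] := well_posed_approx_sol_ball wp d2.
  exists e => // u v /ball_s us /ball_s vs.
  by have := prod_norm_ball us vs; rewrite mulrC divfK.
have conv z := @approximating_cvg _ _ _ _ _ _ _ _ s z Ss small.
exists s; split=> //; apply/seteqP; split=> [t St|_ ->//].
(* A second solution t is the limit s of the constant sequence t. *)
have /conv/cvg_lim : sep_approximating C Q A f g (fun=> t).
  apply: sep_approximating_harmonic => n.
  by apply: sep_sol_approx St; exact: harmonic_ge0.
move=> /(_ (@norm_hausdorff _ _)); rewrite lim_cst; last exact: norm_hausdorff.
by move=> /prod_norm_eq0/subr0_eq.
Qed.
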